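(* Let $G$ be a finite group and let $G=AB$ be the product of the subgroups $A$ and $B$. Then this is a Baer factorisation if and only if, for every prime $p$, $|G:C_G(A_p)|$ and $|G:C_G(B_p)|$ are prime powers, where $A_p$ is a Sylow $p$-subgroup of $A$ and $B_p$ is a Sylow $p$-subgroup of $B$.
   Context: All groups are finite. For $x\in G$, the index of $x$ in $G$ is $i_G(x)=|G:C_G(x)|$. The number $1$ is regarded as a power of every prime. ''$G=AB$ is the product of the subgroups $A$ and $B$'' means that $G=\{ab : a\in A, b\in B\}$. $G=AB$ is a Baer factorisation if $i_G(x)$ is a prime power for every element $x\in A\cup B$ of prime power order. *)

(* Defs.v *)
From mathcomp Require Import all_boot all_fingroup all_solvable.
Set Implicit Arguments.
Unset Strict Implicit.
Unset Printing Implicit Defensive.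
Local Open Scope group_scope.

(* The exponent may be 0, so 1 is a prime power. *)
Definition prime_power (n : nat) : Prop :=
  exists p k : nat, prime p /\ n = (p ^ k)%N.

Definition elt_index (gT : finGroupType) (G : {group gT}) (x : gT) : nat :=
  #|G : 'C_G[x]|.

Definition baer_factorisation (gT : finGroupType) (G A B : {group gT}) : Prop :=
  A * B = G /\
  forall x : gT, x \in A :|: B -> prime_power #[x] ->
    prime_power (elt_index G x).

(* Main.v *)
(* Two commuting elements of coprime indices have commuting normal closures.
   Applied to elements of prime power order of A and B, with Burnside's
   p^a q^b theorem, this shows that G is solvable.  Put K = O_{p'}(G).  Since
   the Fitting subgroup contains its centraliser, G / K has a normal Sylow
   p-subgroup O, and (G / K) / O is abelian: a nontrivial q-element of the image
   of A or B (q <> p) acts nontrivially on O, so its index is a power of p and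
   it is central modulo O.
   Let P be a Sylow p-subgroup of A, contained in a Sylow p-subgroup S of G.
   If P does not centralise S, then P centralises all Sylow r-subgroups of G
   with r <> p.  Otherwise fix Hall {p,q}-subgroups E_q containing S; an element
   of P not centralising E_q has index a power of q, and multiplying two
   elements shows that P fails to centralise E_q for at most one q. *)
Require Import Defs.
From mathcomp Require Import all_boot all_fingroup all_solvable.
From mathcomp Require Import integral_char.
Set Implicit Arguments.
Unset Strict Implicit.
Unset Printing Implicit Defensive.
Local Open Scope group_scope.

(* A nonprime q is harmless here: q.-nat n then forces n = 1. *)
Definition pelt_pindex (gT : finGroupType) (G X : {set gT}) : Prop :=
  forall (p : nat) x, x \in X -> p.-elt x ->
    exists q : nat, q.-nat #|G : 'C_G[x]|.

Lemma pnat_pdiv (q n : nat) : q.-nat n -> 1 < n -> q = pdiv n.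
Proof.
move=> q_n n_gt1; have [n_gt0 _] := andP q_n.
exact/esym/eqnP/(pnatP _ n_gt0 q_n _ (pdiv_prime n_gt1) (pdiv_dvd n)).
Qed.

Lemma prime_powerP n : prime_power n <-> exists q : nat, q.-nat n.
Proof.
split=> [[p [k [p_pr ->]]] | [q q_n]]; first by exists p; rewrite pnatX pnat_id.
have [q_pr | q_npr] := boolP (prime q).
  by exists q, (logn q n); split; rewrite // -p_part part_pnat_id.
exists 2, 0; split=> //; have [n_gt0 _] := andP q_n.
apply/eqP; rewrite eqn_leq n_gt0 andbT leqNgt; apply/negP=> n_gt1.
by rewrite (pnat_pdiv q_n n_gt1) pdiv_prime in q_npr.
Qed.

(** * Indices of centralisers, and elements whose indices are coprime *)

Section Index.

Variable gT : finGroupType.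
Implicit Types (A G H K E R : {group gT}) (p q : nat) (pi : nat_pred).

Lemma pHall_index_trans pi G H K :
  H \subset G -> pi^'.-nat #|G : H| -> pi.-Hall(H) K -> pi.-Hall(G) K.
Proof.
move=> sHG pi'GH /and3P[sKH piK pi'HK].
rewrite /pHall (subset_trans sKH) // piK /=.
by rewrite -(Lagrange_index sHG sKH) pnatM pi'GH.
Qed.

Lemma pnat_index_Hall pi G E H :
  pi.-Hall(G) E -> E \subset H -> pi^'.-nat #|G : H|.
Proof.
by case/and3P=> _ _ pi'GE sEH; apply: pnat_dvd (indexgS G sEH) pi'GE.
Qed.

Lemma index_cent1J G x g :
  g \in G -> #|G : 'C_G[x ^ g]| = #|G : 'C_G[x]|.
Proof. by move=> Gg; rewrite !index_cent1 classGidl. Qed.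

(** The left side is the index of ['C_G[x]] in its product with [H], which is a subgroup of [G]. *)
Lemma index_cent1_normal G H x :
  H <| G -> #|H : 'C_H[x]| %| #|G : 'C_G[x]|.
Proof.
case/andP=> sHG nHG; have sCG := subcent1_sub x G.
have ->: 'C_H[x] = H :&: 'C_G[x] by rewrite setIA (setIidPl sHG).
rewrite indexgI -indexMg -norm_joinEl ?(subset_trans sCG) //.
by rewrite indexSg ?joing_subl // join_subG sCG.
Qed.

Lemma index_cent1_quotient G H x :
  H <| G -> x \in G -> #|G / H : 'C_(G / H)[coset H x]| %| #|G : 'C_G[x]|.
Proof.
case/andP=> _ nHG Gx.
apply: dvdn_trans (index_quotient (G := G) (K := 'C_G[x]) _).
  exact: indexgS (quotient_subcent1 _ _ _).
exact: subset_trans (subsetIl _ _) nHG.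
Qed.

Lemma pelt_pindexU G (X Y : {set gT}) :
  pelt_pindex G (X :|: Y) <-> pelt_pindex G X /\ pelt_pindex G Y.
Proof.
split=> [ind | [indX indY] p x /setUP[] Xx]; [|exact: indX | exact: indY].
by split=> p x Xx; apply: ind; rewrite inE Xx ?orbT.
Qed.

Lemma pelt_pindex_quotient G H A :
  H <| G -> A \subset G -> pelt_pindex G A -> pelt_pindex (G / H) (A / H).
Proof.
move=> nsHG sAG indA p _ /morphimP[x Nx Ax ->] /= p_x.
(* A [p]-element of the quotient is also the image of the [p]-part of any of its preimages. *)
have Axp: x.`_p \in A by rewrite groupX.
have [q q_x] := indA p _ Axp (p_elt_constt p x).
exists q; rewrite -(constt_p_elt p_x) -morph_constt //.
by apply: pnat_dvd q_x; rewrite index_cent1_quotient // (subsetP sAG).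
Qed.

Lemma Sylow_sub_cent1 p G x :
    p^'.-nat #|G : 'C_G[x]| ->
  exists2 S : {group gT}, p.-Sylow(G) S & S \subset 'C[x].
Proof.
move=> p'x; have [S sylS] := Sylow_exists p 'C_G[x].
exists S; first exact: pHall_index_trans (subcent1_sub x G) p'x sylS.
by case/subsetIP: (pHall_sub sylS).
Qed.

Lemma pcore_cent1 p q G x :
  q.-nat #|G : 'C_G[x]| -> q != p -> 'O_p(G) \subset 'C[x].
Proof.
move=> q_x qNp; have [|S sylS] := @Sylow_sub_cent1 p G x.
  by apply: pi_pnat q_x _; rewrite !inE.
exact: subset_trans (pcore_sub_Hall sylS).
Qed.

(** [<[x]>] is a normal [pi]-subgroup of ['C_G[x]], so it lies in every Hall [pi]-subgroup there. *)
Lemma mem_Hall_cent1 pi G E x :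
  x \in G -> pi.-elt x -> pi.-Hall('C_G[x]) E -> x \in E.
Proof.
move=> Gx pi_x hallE; rewrite -cycle_subG.
apply: subset_trans (pcore_sub_Hall hallE).
by rewrite pcore_max // subcent1_cycle_normal.
Qed.

(** If [S] is a Sylow [p]-subgroup containing [x], then [G] is the product of ['C_G[x]] and [S].
    Hence all conjugates of [x] lie in [S], and its normal closure is a [p]-group. *)
Lemma mem_pcore_index p G x :
  x \in G -> p.-elt x -> p.-nat #|G : 'C_G[x]| -> x \in 'O_p(G).
Proof.
move=> Gx p_x p_iG.
have [S sylS sxS]: {S : {group gT} | p.-Sylow(G) S & <[x]> \subset S}.
  by apply: Sylow_superset; rewrite ?cycle_subG.
have [sSG pS p'GS] := and3P sylS.
have defG: 'C_G[x] * S = G.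
  apply: coprime_index_mulG; rewrite ?subcent1_sub //.
  exact: pnat_coprime p_iG p'GS.
have Cx: x \in <<x ^: G>> by rewrite mem_gen ?class_refl.
apply: subsetP Cx; rewrite pcore_max //.
  apply: pgroupS pS; rewrite gen_subG; apply/subsetP=> _ /imsetP[g Gg ->].
  move: Gg; rewrite -{1}defG => /mulsgP[c s /setIP[_ /cent1P cxc] Ss ->].
  have /conjg_fixP xc: [~ x, c] == 1 by apply/commgP/commute_sym.
  by rewrite conjgM xc groupJ // -cycle_subG.
by rewrite /normal gen_subG class_subG // norms_gen // class_norm.
Qed.

(** Both centralisers contain a full Sylow [q]-subgroup of [G], and the one for [z] contains [z];
    Sylow conjugacy moves [z] into ['C_G[x]]. *)
Lemma commute_conj_index q G x z :
    x \in G -> z \in G -> q.-elt z ->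
    q^'.-nat #|G : 'C_G[x]| -> q^'.-nat #|G : 'C_G[z]| ->
  exists2 g, g \in G & commute x (z ^ g).
Proof.
move=> Gx Gz q_z q'x q'z.
have [Q sylQ] := Sylow_exists q 'C_G[x].
have [R sylR] := Sylow_exists q 'C_G[z].
have Rz := mem_Hall_cent1 Gz q_z sylR.
have sCG y := subcent1_sub y G.
have [g Gg defQ] := Sylow_trans (pHall_index_trans (sCG z) q'z sylR)
                     (pHall_index_trans (sCG x) q'x sylQ).
have: z ^ g \in 'C_G[x].
  by rewrite (subsetP (pHall_sub sylQ)) // defQ memJ_conjg.
by case/setIP=> _ /cent1P; exists g.
Qed.

(** Coprimality makes [G] the product of the two centralisers. Writing [g = c * d] accordingly,
    [x ^ g = x ^ d] commutes with [z ^ d = z]. *)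
Lemma cents_class_coprime G x z :
    x \in G -> z \in G -> commute x z ->
    coprime #|G : 'C_G[x]| #|G : 'C_G[z]| ->
  <<x ^: G>> \subset 'C(<<z ^: G>>).
Proof.
move=> Gx Gz cxz co_xz.
have defG: 'C_G[x] * 'C_G[z] = G.
  by apply: coprime_index_mulG; rewrite ?subcent1_sub.
have cz g: g \in G -> commute (x ^ g) z.
  rewrite -{1}defG.
  case/mulsgP=> c d /setIP[_ /cent1P cxc] /setIP[_ /cent1P czd] ->.
  have /conjg_fixP xc: [~ x, c] == 1 by apply/commgP/commute_sym.
  have /conjg_fixP zd: [~ z, d] == 1 by apply/commgP/commute_sym.
  by rewrite conjgM xc /commute -{1 2}zd -!conjMg cxz.
rewrite gen_subG centsC gen_subG centsC; apply/subsetP=> _ /imsetP[g Gg ->].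
apply/centP=> _ /imsetP[h Gh ->].
have:= cz (g * h^-1) (groupM Gg (groupVr Gh)).
by move/(congr1 (conjg^~ h)); rewrite /= (conjMg _ z) (conjMg z) -conjgM mulgKV.
Qed.

End Index.

(** * Solvability of [G] *)

(* In a counterexample of minimal order nontrivial normal subgroups never
   centralise each other, so commuting nontrivial elements of prime power index
   have indices that are powers of the same prime.  Comparing elements for
   three primes p, q, r, where r divides the index of a p-element, gives a
   contradiction. *)
Theorem pelt_pindex_sol gT (G A B : {group gT}) :
    A \subset G -> B \subset G -> A * B = G -> pelt_pindex G (A :|: B) ->
  solvable G.
Proof.
have [n] := ubnP #|G|; elim: n gT G A B => // n IHn gT G A B /ltnSE leGn.
move=> sAG sBG defG indAB.
have [indA indB] := (pelt_pindexU G A B).1 indAB.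
have solQ (N : {group gT}) : N <| G -> N :!=: 1 -> solvable (G / N).
  move=> nsNG ntN; have [_ nNG] := andP nsNG.
  apply: (IHn _ (G / N)%G (A / N)%G (B / N)%G); rewrite ?quotientS //=.
  - exact: leq_trans (ltn_quotient ntN (normal_sub nsNG)) leGn.
  - by rewrite -quotientMl ?defG // (subset_trans sAG).
  by apply/pelt_pindexU; split; apply: pelt_pindex_quotient.
apply/idPn=> nsolG.
have noN (N : {group gT}) : N <| G -> solvable N -> N :=: 1.
  move=> nsNG solN; apply/eqP/idPn=> ntN.
  by rewrite (series_sol nsNG) solN solQ in nsolG.
(* The two normal closures centralise each other, so their intersection is abelian and normal, hence
   trivial. The closure of [z] then embeds in the solvable quotient by the closure of [x], so it is
   solvable and thus trivial. *)
have noC x z : x \in G -> z \in G -> x != 1 -> z != 1 -> commute x z ->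
    coprime #|G : 'C_G[x]| #|G : 'C_G[z]| -> False.
  move=> Gx Gz ntx ntz cxz co_xz.
  have cXZ := cents_class_coprime Gx Gz cxz co_xz.
  have nsX y: y \in G -> <<y ^: G>> <| G.
    move=> Gy; rewrite /normal gen_subG class_subG // norms_gen //.
    exact: class_norm.
  have ntX y: y != 1 -> <<y ^: G>> != 1.
    apply: contraNneq => y1; rewrite -in_set1 -[[set 1]]y1.
    by rewrite mem_gen ?class_refl.
  have solX := solQ _ (nsX x Gx) (ntX x ntx).
  have abI: abelian (<<z ^: G>> :&: <<x ^: G>>).
    rewrite /abelian subIset // (subset_trans _ (centS (subsetIr _ _))) //.
    by rewrite centsC.
  have tiXZ: <<x ^: G>> :&: <<z ^: G>> = 1.
    rewrite setIC (noN _ (normalI (nsX z Gz) (nsX x Gx))) //.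
    exact: abelian_sol.
  have nXZ: <<z ^: G>> \subset 'N(<<x ^: G>>).
    by rewrite (subset_trans (normal_sub (nsX z Gz))) // normal_norm ?nsX.
  have solZ: solvable (<<z ^: G>>).
    rewrite (isog_sol (quotient_isog nXZ tiXZ)).
    by apply: solvableS solX; rewrite quotientS // normal_sub ?nsX.
  by have/eqP := noN _ (nsX z Gz) solZ; apply/negP/ntX.
have noCq q x z : prime q -> x \in G -> z \in G -> x != 1 -> z != 1 ->
  q.-elt z -> forall r s, prime r -> prime s ->
  r.-nat #|G : 'C_G[x]| -> s.-nat #|G : 'C_G[z]| -> r != q -> s != q -> r = s.
- move=> q_pr Gx Gz ntx ntz q_z r s r_pr s_pr r_x s_z rNq sNq.
  apply/eqP/idPn=> rNs.
  have [|| g Gg cxzg] := @commute_conj_index _ q G x z Gx Gz q_z.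
  - by apply: pi_pnat r_x _; rewrite !inE.
  - by apply: pi_pnat s_z _; rewrite !inE.
  apply: (noC x (z ^ g)); rewrite ?groupJ ?conjg_eq1 // index_cent1J //.
  by apply: (pnat_coprime r_x); apply: pi_pnat s_z _; rewrite !inE eq_sym.
(* Such an element can be taken of order [p] in [A] or [B]. Its index is not 1 because the centre is
   trivial, and not a power of [p] because ['O_p(G)] is trivial. *)
have exP p: prime p -> p %| #|G| -> exists x (r : nat),
  [/\ x \in G, x != 1, p.-elt x, r.-nat #|G : 'C_G[x]|
    & [/\ prime r, r %| #|G| & r != p]].
- move=> p_pr pG.
  have [x ABx ox]: exists2 x, x \in A :|: B & #[x] = p.
    have: p %| #|A| * #|B| by rewrite (dvdn_trans pG) // -defG dvdn_cardMg.
    rewrite Euclid_dvdM // => /orP[] /Cauchy[] // x Xx ox;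
      by exists x; rewrite // inE Xx ?orbT.
  have Gx: x \in G by case/setUP: ABx; apply: subsetP.
  have p_x: p.-elt x by rewrite /p_elt ox pnat_id.
  have ntx: x != 1 by rewrite -order_gt1 ox prime_gt1.
  have [r r_x] := indAB p x ABx p_x; exists x, r; split=> //.
  have iG_gt1: 1 < #|G : 'C_G[x]|.
    rewrite indexg_gt1; apply/negP=> /subsetIP[_ cGx].
    have: x \in 'Z(G) by rewrite inE Gx -sub_cent1.
    rewrite (noN _ (center_normal G)) ?inE ?(negPf ntx) //.
    exact: abelian_sol (center_abelian G).
  have Dr := pnat_pdiv r_x iG_gt1.
  have r_pr: prime r by rewrite Dr pdiv_prime.
  have r_G: r %| #|G| by rewrite Dr (dvdn_trans (pdiv_dvd _)) ?dvdn_indexg.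
  split=> //; apply: contraNneq ntx => rp; rewrite rp in r_x.
  have:= mem_pcore_index Gx p_x r_x.
  rewrite (noN _ (pcore_normal _ _)) ?inE //.
  exact: nilpotent_sol (pgroup_nil (pcore_pgroup _ _)).
have: ~~ (size (primes #|G|) <= 2) by apply: contra nsolG => /Burnside_p_a_q_b.
rewrite -ltnNge => gt2.
pose p := nth 0 (primes #|G|) 0.
have Pp: p \in primes #|G| by rewrite mem_nth // (ltn_trans _ gt2).
rewrite mem_primes in Pp; have{Pp} [p_pr _ pG] := and3P Pp.
have [x [r [Gx ntx p_x r_x [r_pr rG rNp]]]] := exP p p_pr pG.
have [q [q_pr qG qNp qNr]]: exists q : nat,
  [/\ prime q, q %| #|G|, q != p & q != r].
  have: ~~ all (mem [:: p; r]) (primes #|G|).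
    apply/negP=> /allP sPpr; have:= uniq_leq_size (primes_uniq _) sPpr.
    by rewrite leqNgt gt2.
  case/allPn=> q; rewrite mem_primes !inE negb_or.
  by case/and3P=> q_pr _ qG /andP[]; exists q.
have [z [s [Gz ntz q_z s_z [s_pr sG sNq]]]] := exP q q_pr qG.
(* Comparing [x] with [z] at [q] gives [r = s]. Comparing [u] with [x] at [p] and with [z] at [q]
   then forces [t] to equal both [p] and [q]. *)
have Drs: r = s by apply: (noCq q x z) r_x s_z _ _; rewrite // eq_sym.
have [u [t [Gu ntu r_u t_u [t_pr tG tNr]]]] := exP r r_pr rG.
have tp: t = p.
  apply: contraNeq tNr => tNp.
  by rewrite (noCq p u x p_pr Gu Gx ntu ntx p_x t r t_pr r_pr t_u r_x).
have tq: t = q.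
  apply: contraNeq tNr => tNq; rewrite Drs.
  by rewrite (noCq q u z q_pr Gu Gz ntu ntz q_z t s t_pr s_pr t_u s_z).
by rewrite -tq tp eqxx in qNp.
Qed.

(** * Solvable groups with trivial [p']-core, and their Sylow [p]-subgroups *)

Section Structure.

Variable gT : finGroupType.
Implicit Types (A B G H K E R P Q S : {group gT}) (p q r : nat).

(** A Hall [pi]-subgroup of ['C_N[x]], with [N = K <*> E], has the form [E :^ k] with [k] in [K], so
    [E] centralises [y = x ^ k^-1]. Now [x^-1 * y] is a [p]-element, as [x] and [y] commute, and it
    lies in the [p']-group [K]; hence [y = x]. *)
Lemma Hall_cent1_normal pi p G K E x :
    solvable G -> p^'.-group K -> K <| G -> K <*> E <| G ->
    pi.-Hall(G) E -> x \in E -> p.-elt x -> pi^'.-nat #|G : 'C_G[x]| ->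
  E \subset 'C[x].
Proof.
move=> solG p'K nsKG nsNG hallE Ex p_x pi'x.
have [sEG piE _] := and3P hallE; set N := (K <*> E)%G in nsNG.
have [sKG nKG] := andP nsKG; have [sNG _] := andP nsNG.
have sEN: E \subset N := joing_subr K E.
have hallEN := pHall_subl sEN sNG hallE.
have [F hallF]: exists F : {group gT}, pi.-Hall('C_N[x]) F.
  by apply: Hall_exists (solvableS _ solG); rewrite subIset ?sNG.
have pi'Nx: pi^'.-nat #|N : 'C_N[x]|.
  exact: pnat_dvd (index_cent1_normal x nsNG) pi'x.
have hallFN := pHall_index_trans (subcent1_sub x N) pi'Nx hallF.
have [n Nn defF] := Hall_trans (solvableS sNG solG) hallFN hallEN.
have pi_x: pi.-elt x by apply: mem_p_elt Ex.
have Nx: x \in N := subsetP sEN x Ex.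
have Fx: x \in F := mem_Hall_cent1 Nx pi_x hallF.
have cxF: F \subset 'C[x] by case/subsetIP: (pHall_sub hallF).
have defN: E * K = N by rewrite /= joingC norm_joinEl // (subset_trans sEG).
move: Nn; rewrite -defN => /mulsgP[e k Ee Kk def_n].
have{n def_n} defF: F :=: E :^ k by rewrite defF def_n conjsgM conjGid.
pose y := x ^ k^-1.
have Ey: y \in E by rewrite -mem_conjg -defF.
have cyE: E \subset 'C[y].
  by rewrite -(conjSg _ _ k) -defF -cent1J /y conjgKV.
have cxy: commute x y by apply/cent1P/(subsetP cyE).
have p_y: p.-elt y by rewrite p_eltJ.
suffices /eqP xy1: x^-1 * y == 1 by rewrite -(mulKVg x y) xy1 mulg1 in cyE.
rewrite -order_eq1; apply/eqP; apply: (@pnat_1 p).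
  by apply: p_eltM; rewrite ?p_eltV //; apply/commute_sym/commuteV/commute_sym.
apply: (mem_p_elt p'K); rewrite -commgEl commgEr groupM ?groupV //.
by rewrite memJ_norm ?groupV // (subsetP nKG) // (subsetP sEG).
Qed.

(** Order count: [P :&: Q] has order at most the [p]-part of [#|A :&: B|], so [P * Q] has at least
    [#|S|] elements. *)
Lemma mulg_Sylow p A B G P Q S :
    A * B = G -> p.-Sylow(A) P -> p.-Sylow(B) Q -> p.-Sylow(G) S ->
    P \subset S -> Q \subset S ->
  P * Q = S.
Proof.
move=> defG sylP sylQ sylS sPS sQS; apply/eqP; rewrite eqEcard mul_subG //=.
have pPQ: p.-group (P :&: Q).
  exact: pgroupS (subsetIl _ _) (pHall_pgroup sylP).
have sPQ: P :&: Q \subset A :&: B.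
  by rewrite setISS // ?(pHall_sub sylP) ?(pHall_sub sylQ).
have lePQ: #|P :&: Q| <= #|A :&: B|`_p.
  by rewrite -(part_pnat_id pPQ) dvdn_leq ?part_gt0 // partn_dvd ?cardSg.
rewrite -(leq_pmul2r (cardG_gt0 (P :&: Q))) -mul_cardG.
rewrite (card_Hall sylP) (card_Hall sylQ) -partnM // mul_cardG defG.
by rewrite partnM // -(card_Hall sylS) leq_mul2l lePQ orbT.
Qed.

Lemma nilpotent_central_ext G H :
  H \subset 'Z(G) -> nilpotent (G / H) -> nilpotent G.
Proof.
move=> sHZ /lcnP[n Ln1]; have [sHG cGH] := subsetIP sHZ.
have nHG: G \subset 'N(H) by rewrite cents_norm // centsC.
have sLH: 'L_n.+1(G) \subset H.
  rewrite -quotient_sub1 ?(subset_trans (lcn_sub _ _) nHG) //.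
  by rewrite [_ / _]morphim_lcn // subG1; apply/eqP.
by apply/lcnP; exists n.+1; apply/commG1P/(subset_trans sLH).
Qed.

(** The preimage [M] of ['F(G / 'Z(G))] is nilpotent and normal, so it lies in ['F(G)], hence in the
    centre. Thus the solvable group [G / 'Z(G)] has trivial Fitting subgroup and is trivial. *)
Lemma abelian_Fitting_central G :
  solvable G -> 'F(G) \subset 'Z(G) -> abelian G.
Proof.
move=> solG sFZ; set M := (coset 'Z(G) @*^-1 'F(G / 'Z(G)))%G.
have nsZG: 'Z(G) <| G := center_normal G.
have nsMG: M <| G.
  by rewrite -(quotientGK nsZG) cosetpre_normal Fitting_normal.
have sZM: 'Z(G) \subset 'Z(M).
  rewrite subsetI sub_cosetpre centsC (subset_trans (normal_sub nsMG)) //.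
  by rewrite centsC subsetIr.
have nilM: nilpotent M.
  by apply: nilpotent_central_ext sZM _; rewrite /= cosetpreK Fitting_nil.
have sMZ: M \subset 'Z(G) := subset_trans (Fitting_max nsMG nilM) sFZ.
have: 'F(G / 'Z(G)) == 1 by rewrite -(cosetpreK 'F(_)) quotientS1.
rewrite trivg_Fitting ?quotient_sol // => /eqP/trivgP.
rewrite quotient_sub1 ?normal_norm // => sGZ.
exact: subset_trans sGZ (subsetIr _ _).
Qed.

Lemma cent_sub_Fitting G : solvable G -> 'C_G('F(G)) \subset 'F(G).
Proof.
move=> solG; set C := 'C_G('F(G))%G.
have nsCG: C <| G.
  by rewrite /normal subsetIl normsI ?normG // norms_cent // gFnorm.
have sFF: 'F(C) \subset 'F(G).
  by rewrite Fitting_max ?Fitting_nil // gFnormal_trans.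
apply: (Fitting_max nsCG); apply: abelian_nil.
apply: abelian_Fitting_central; first exact: solvableS (normal_sub nsCG) solG.
rewrite subsetI Fitting_sub centsC.
exact: subset_trans (subsetIr _ _) (centS sFF).
Qed.

(** For [q] different from [p], [x] centralises ['O_p(G)], which is here the Fitting subgroup and
    contains its centraliser. *)
Lemma pelt_pindex_pcore p G x q :
    solvable G -> 'O_p^'(G) = 1 -> x \in G -> p.-elt x ->
    q.-nat #|G : 'C_G[x]| ->
  x \in 'O_p(G).
Proof.
move=> solG p'G1 Gx p_x q_x; have [Dq | qNp] := eqVneq q p.
  by rewrite Dq in q_x; apply: mem_pcore_index.
have:= cent_sub_Fitting solG; rewrite (Fitting_eq_pcore p'G1).
by move/subsetP; apply; rewrite inE Gx -sub_cent1 (pcore_cent1 q_x).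
Qed.

Lemma p'group_quotient p A H :
    prime p -> A \subset 'N(H) -> (forall x, x \in A -> p.-elt x -> x \in H) ->
  p^'.-group (A / H).
Proof.
move=> p_pr nHA sAH; have [P sylP] := Sylow_exists p A.
have:= quotient_pHall (subset_trans (pHall_sub sylP) nHA) sylP.
have/quotientS1->: P \subset H.
  apply/subsetP=> x Px; apply: sAH; first exact: subsetP (pHall_sub sylP) x Px.
  exact: mem_p_elt (pHall_pgroup sylP) Px.
by move/card_Hall/esym/eqP; rewrite cards1 partn_eq1.
Qed.

(** All [p]-elements of [A] and [B] lie in ['O_p(G)], so both images in the quotient are
    [p']-groups, and so is their product. *)
Lemma pelt_pindex_pcore_Sylow p G A B :
    prime p -> solvable G -> 'O_p^'(G) = 1 -> A * B = G ->
    pelt_pindex G (A :|: B) ->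
  p.-Sylow(G) 'O_p(G).
Proof.
move=> p_pr solG p'G1 defG indAB.
have nOG := normal_norm (pcore_normal p G).
have [sAG sBG]: A \subset G /\ B \subset G by rewrite -defG mulG_subl mulG_subr.
have p'X (X : {group gT}) :
  X \subset A :|: B -> X \subset G -> p^'.-group (X / 'O_p(G)).
- move=> sXAB sXG; apply: p'group_quotient => // [|x Xx p_x].
    exact: subset_trans nOG.
  have [q q_x] := indAB p x (subsetP sXAB x Xx) p_x.
  by apply: pelt_pindex_pcore q_x; rewrite // (subsetP sXG).
have defGO: (A / 'O_p(G)) * (B / 'O_p(G)) = G / 'O_p(G).
  by rewrite -quotientMl ?defG // (subset_trans sAG).
rewrite /pHall pcore_sub pcore_pgroup -card_quotient //= -defGO.
apply: pnat_dvd (dvdn_cardMg _ _) _; rewrite pnatM.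
by apply/andP; split; apply: p'X; rewrite ?subsetUl ?subsetUr.
Qed.

Lemma pelt_pindex_cents_pcore p G A :
    prime p -> solvable G -> 'O_p^'(G) = 1 -> p.-Sylow(G) 'O_p(G) ->
    A \subset G -> pelt_pindex G A ->
  A / 'O_p(G) \subset 'C(G / 'O_p(G)).
Proof.
move=> p_pr solG p'G1 sylO sAG indA; set O := 'O_p(G)%G.
have nOG: G \subset 'N(O) := gFnorm _ G.
rewrite -(Sylow_gen (A / O)) gen_subG; apply/bigcupsP=> Q.
case/SylowP=> q q_pr sylQ; apply/subsetP=> y Qy.
have q_y := mem_p_elt (pHall_pgroup sylQ) Qy.
have /morphimP[x0 Nx0 Ax0 /= def_y] := subsetP (pHall_sub sylQ) y Qy.
rewrite -(constt_p_elt q_y) def_y -morph_constt //=.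
have: x0.`_q \in A by rewrite groupX.
move: (p_elt_constt q x0); move: x0.`_q => x q_x Ax {y x0 Qy q_y Nx0 Ax0 def_y}.
have Gx := subsetP sAG x Ax; rewrite -sub_cent1.
have [s s_x] := indA q x Ax q_x.
have [Dq | qNp] := eqVneq q p.
  rewrite Dq in q_x s_x; rewrite coset_id ?(pelt_pindex_pcore _ _ _ _ s_x) //.
  by apply/subsetP=> z _; apply/cent1P; apply: commute1.
have p'x: p^'.-elt x by apply: pi_pnat q_x _; rewrite !inE.
have [x1 | ntx] := eqVneq x 1.
  by rewrite x1 morph1; apply/subsetP=> z _; apply/cent1P; apply: commute1.
have iO_gt1: 1 < #|O : 'C_O[x]|.
  rewrite indexg_gt1; apply: contra ntx => /subsetIP[_].
  rewrite sub_cent1 => cOx.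
  have Ox: x \in O.
    have:= cent_sub_Fitting solG; rewrite (Fitting_eq_pcore p'G1).
    by move/subsetP; apply; rewrite inE Gx.
  by rewrite -order_eq1 (pnat_1 (mem_p_elt (pcore_pgroup p G) Ox) p'x).
have Ds: s = p.
  have s_Ox := pnat_dvd (index_cent1_normal x (pcore_normal p G)) s_x.
  rewrite (pnat_pdiv s_Ox iO_gt1); apply/esym/pnat_pdiv => //.
  exact: pnat_dvd (dvdn_indexg _ _) (pcore_pgroup p G).
(* This index divides a power of [p] and also the order of the [p']-group [G / O]. *)
have: #|G / O : 'C_(G / O)[coset O x]| = 1%N.
  rewrite Ds in s_x; apply: (@pnat_1 p).
    by apply: pnat_dvd s_x; apply: index_cent1_quotient; rewrite ?pcore_normal.
  apply: pnat_dvd (dvdn_indexg _ _) _.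
  by rewrite card_quotient //; case/and3P: sylO.
by move/eqP; rewrite indexg_eq1 => /subsetIP[].
Qed.

Lemma pelt_pindex_abelian_pcore p G A B :
    prime p -> solvable G -> 'O_p^'(G) = 1 -> A * B = G ->
    pelt_pindex G (A :|: B) ->
  abelian (G / 'O_p(G)).
Proof.
move=> p_pr solG p'G1 defG indAB.
have [indA indB] := (pelt_pindexU G A B).1 indAB.
have sylO := pelt_pindex_pcore_Sylow p_pr solG p'G1 defG indAB.
have [sAG sBG]: A \subset G /\ B \subset G by rewrite -defG mulG_subl mulG_subr.
have nOA: A \subset 'N('O_p(G)) by apply: subset_trans (gFnorm _ G).
have defGO: (A / 'O_p(G)) * (B / 'O_p(G)) = G / 'O_p(G).
  by rewrite -quotientMl ?defG.
rewrite /abelian -{1}defGO mul_subG //;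
  exact: pelt_pindex_cents_pcore.
Qed.

(* With S = O_p(G), the p-elements of A and B generate S and each is central in
   S or S-conjugate into C_S(R), so S = Z(S) C_S(R) S' = Z(S) C_S(R). *)
Lemma cent1_Sylow_pindex p r G A B R x :
    prime p -> A * B = G -> pelt_pindex G (A :|: B) ->
    p.-Sylow(G) 'O_p(G) -> r.-Sylow(G) R -> r != p ->
    x \in A :|: B -> p.-elt x -> p.-nat #|G : 'C_G[x]| ->
  R \subset 'C[x].
Proof.
move=> p_pr defG indAB sylS sylR rNp ABx p_x iGx.
have [sAG sBG]: A \subset G /\ B \subset G by rewrite -defG mulG_subl mulG_subr.
have [P sylP] := Sylow_exists p A; have [Q sylQ] := Sylow_exists p B.
set S := 'O_p(G)%G; have pS: p.-group S := pcore_pgroup p G.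
have nsSG: S <| G := pcore_normal p G.
have memS y: y \in G -> p.-elt y -> y \in S.
  by move=> Gy p_y; rewrite (mem_normal_Hall sylS).
have subS (X Y : {group gT}) : p.-Sylow(X) Y -> X \subset G -> Y \subset S.
  move=> sylY sXG; rewrite (sub_normal_Hall sylS) ?(pHall_pgroup sylY) //.
  exact: subset_trans (pHall_sub sylY) sXG.
have [sPS sQS] := (subS A P sylP sAG, subS B Q sylQ sBG).
have defS: P * Q = S := mulg_Sylow defG sylP sylQ sylS sPS sQS.
(* Some conjugate [R1] of [R] centralises [y]. The conjugating element factors as [c * s] with [c]
   centralising [y], so [s] alone carries [y] into the centraliser of [R]. *)
have conj_cent y: y \in S -> p.-nat #|G : 'C_G[y]| ->
  exists2 s, s \in S & y ^ s \in 'C_S(R).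
- move=> Sy p_iy; have [|R1 sylR1 cR1y] := @Sylow_sub_cent1 _ r G y.
    by apply: pi_pnat p_iy _; rewrite !inE eq_sym.
  have [g Gg defR] := Sylow_trans sylR1 sylR.
  have defCS: 'C_G[y] * S = G.
    apply: coprime_index_mulG; rewrite ?subcent1_sub ?normal_sub //.
    by case/and3P: sylS => _ _; apply: pnat_coprime.
  move: Gg; rewrite -{1}defCS => /mulsgP[c s /setIP[_ /cent1P cyc] Ss def_g].
  have /conjg_fixP yc: [~ y, c] == 1 by apply/commgP/commute_sym.
  exists s; rewrite // inE groupJ //= -sub_cent1 -{1}yc -conjgM -def_g defR.
  by rewrite cent1J conjSg.
(* Generation is checked modulo ['Phi(S)], which contains the derived subgroup; there [y] and
   [y ^ s] agree. *)
have genS: S \subset <<'Z(S) :|: 'C_S(R)>>.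
  rewrite (@Phi_nongen _ S) //; apply/eqP.
  set X := 'Z(S) :|: 'C_S(R); set T := 'Phi(S) <*> X.
  have sXT: X \subset T by apply: joing_subr.
  have [sZT sCT]: 'Z(S) \subset T /\ 'C_S(R) \subset T.
    by apply/andP; rewrite -subUset.
  have sS'T: S^`(1) \subset T.
    apply: subset_trans (joing_subl _ _).
    by rewrite (Phi_joing pS) joing_subl.
  rewrite eqEsubset join_subG Phi_sub subUset center_sub subsetIl /=.
  have sTY (Y : {set gT}) : Y \subset A :|: B -> Y \subset S -> Y \subset T.
    move=> sYAB sYS; apply/subsetP=> y Yy; have Sy := subsetP sYS y Yy.
    have p_y := mem_p_elt pS Sy.
    have [q q_y] := indAB p y (subsetP sYAB y Yy) p_y.
    have [Dq | qNp] := eqVneq q p.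
      rewrite Dq in q_y; have [s Ss Cys] := conj_cent y Sy q_y.
      have Tys: y ^ s \in T := subsetP sCT _ Cys.
      rewrite -(conjgK s y) conjg_mulR groupM // (subsetP sS'T) //.
      by rewrite mem_commg ?groupV ?groupJ.
    by rewrite (subsetP sZT) // inE Sy -sub_cent1 (pcore_cent1 q_y).
  rewrite -defS mul_subG // sTY //.
    by rewrite (subset_trans (pHall_sub sylP)) ?subsetUl.
  by rewrite (subset_trans (pHall_sub sylQ)) ?subsetUr.
have defZC: 'Z(S) * 'C_S(R) = S.
  have nZC: 'C_S(R) \subset 'N('Z(S)).
    by rewrite (subset_trans (subsetIl _ _)) ?normal_norm ?center_normal.
  apply/eqP; rewrite eqEsubset mul_subG ?center_sub ?subsetIl //=.
  by rewrite -norm_joinEr.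
have Sx: x \in S by rewrite memS //; case/setUP: ABx; apply: subsetP.
have [s Ss] := conj_cent x Sx iGx.
(* Here [x ^ s = x ^ c], and [c] lies in ['C_S(R)], so [x] itself lies there. *)
have /mulsgP[z c /centerP[_ cSz] Cc ->]: s \in 'Z(S) * 'C_S(R) by rewrite defZC.
have /conjg_fixP xz: [~ x, z] == 1 by apply/commgP/commute_sym/cSz.
by rewrite conjgM xz groupJr // => /setIP[_]; rewrite sub_cent1.
Qed.

End Structure.

(** * Index of the centraliser of a Sylow subgroup of a factor *)

Theorem pindex_cent_Sylow gT p (G A B P : {group gT}) :
    prime p -> A * B = G -> pelt_pindex G (A :|: B) -> p.-Sylow(A) P ->
  exists q : nat, q.-nat #|G : 'C_G(P)|.
Proof.
move=> p_pr defG indAB sylP.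
have [indA indB] := (pelt_pindexU G A B).1 indAB.
have [sAG sBG]: A \subset G /\ B \subset G by rewrite -defG mulG_subl mulG_subr.
have solG := pelt_pindex_sol sAG sBG defG indAB.
have [sPA pP _] := and3P sylP; have sPG := subset_trans sPA sAG.
set K := 'O_p^'(G)%G; have nsKG: K <| G := pcore_normal _ G.
have [_ nKG] := andP nsKG.
have p'K: p^'.-group K := pcore_pgroup _ G.
have p'GK1: 'O_p^'(G / K) = 1 := trivg_pcore_quotient _ G.
have solGK: solvable (G / K) := quotient_sol K solG.
have defGK: (A / K) * (B / K) = G / K.
  by rewrite -quotientMl ?defG // (subset_trans sAG).
have indGK: pelt_pindex (G / K) ((A / K) :|: (B / K)).
  by apply/pelt_pindexU; split; apply: pelt_pindex_quotient.
have sylO := pelt_pindex_pcore_Sylow p_pr solGK p'GK1 defGK indGK.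
have abGO := pelt_pindex_abelian_pcore p_pr solGK p'GK1 defGK indGK.
have [S sylS sPS] := Sylow_superset sPG pP.
have [sSG pS p'GS] := and3P sylS.
(* The quotient by [K] puts [[~ x, y]] in [K] for [y] in [R]. Since [x] lies in ['O_p(G)], so does
   the commutator, and the two cores meet trivially. *)
have cent_Sylow x r (R : {group gT}) :
  x \in P -> p.-nat #|G : 'C_G[x]| -> r.-Sylow(G) R -> r != p ->
  R \subset 'C[x].
- move=> Px p_ix sylR rNp; have Ax := subsetP sPA x Px.
  have Gx := subsetP sAG x Ax.
  have p_x := mem_p_elt pP Px; have Nx := subsetP nKG x Gx.
  have sRG := pHall_sub sylR; have nKR := subset_trans sRG nKG.
  have cRx: R / K \subset 'C[coset K x].
    have sylRK := quotient_pHall nKR sylR.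
    apply: (cent1_Sylow_pindex p_pr defGK indGK sylO sylRK rNp).
    - by rewrite inE mem_quotient.
    - exact: morph_p_elt.
    exact: pnat_dvd (index_cent1_quotient nsKG Gx) p_ix.
  apply/subsetP=> y Ry; apply/cent1P/commute_sym/commgP.
  have Ny := subsetP nKR y Ry; have Gy := subsetP sRG y Ry.
  have Kxy: [~ x, y] \in K.
    apply: coset_idr; first by rewrite groupR.
    rewrite morphR //; apply/eqP/commgP/commute_sym/cent1P.
    by rewrite (subsetP cRx) // mem_quotient.
  have Oxy: [~ x, y] \in 'O_p(G).
    have Ox := mem_pcore_index Gx p_x p_ix.
    rewrite commgEl groupM ?groupV // memJ_norm //.
    exact: subsetP (normal_norm (pcore_normal p G)) y Gy.
  by rewrite -in_set1 -[[set 1]](TI_pcoreC p G G) inE Oxy.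
(* [K <*> E] is normal because the image of [S] in [G / K] contains the derived subgroup of
   [G / K]. *)
have cent_Hall pi (E : {group gT}) x :
  x \in P -> S \subset E -> pi.-Hall(G) E -> pi^'.-nat #|G : 'C_G[x]| ->
  E \subset 'C[x].
- move=> Px sSE hallE pi'x; have sEG := pHall_sub hallE.
  have p_x := mem_p_elt pP Px.
  apply: (Hall_cent1_normal solG p'K nsKG _ hallE _ p_x pi'x); last first.
    exact: subsetP (subset_trans sPS sSE) x Px.
  rewrite -quotientYK ?(subset_trans sEG) // -[X in _ <| X](quotientGK nsKG).
  rewrite cosetpre_normal sub_der1_normal ?quotientS //.
  apply: subset_trans (quotientS K sSE).
  have sylSK := quotient_pHall (subset_trans sSG nKG) sylS.
  apply: subset_trans (pcore_sub_Hall sylSK).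
  by apply: der1_min abGO; apply: normal_norm (pcore_normal _ _).
have pnat_index x: x \in P -> exists q : nat, q.-nat #|G : 'C_G[x]|.
  by move=> Px; apply: (indA p x (subsetP sPA x Px)); apply: mem_p_elt Px.
have cent_mul x y (E : {set gT}) :
  E \subset 'C[x] -> (E \subset 'C[x * y]) = (E \subset 'C[y]).
  by rewrite !sub_cent1 => cEx; rewrite groupMl.
have not_cS x: x \in P -> ~~ (S \subset 'C[x]) -> p.-nat #|G : 'C_G[x]|.
  move=> Px; have [q q_x] := pnat_index x Px; have [<- // | qNp] := eqVneq q p.
  case/negP; apply: cent_Hall sylS _ => //.
  by apply: pi_pnat q_x _; rewrite !inE.
have [cPS | /subsetPn[x Px]] := boolP (P \subset 'C(S)); last first.
  rewrite -sub_cent1 => ncSx; exists p.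
  apply/pnatP=> // r r_pr rG; apply/idPn=> /= rNp.
  have [R sylR] := Sylow_exists r G.
  have cRP: R \subset 'C_G(P).
    rewrite subsetI (pHall_sub sylR) /= centsC; apply/subsetP=> y Py.
    rewrite -sub_cent1; have [cSy | ncSy] := boolP (S \subset 'C[y]).
      (* As [y] centralises [S] and [x] does not, neither does [x * y]. So [R] centralises both [x]
         and [x * y], hence [y]. *)
      rewrite -(cent_mul x) ?(cent_Sylow x r) ?not_cS //.
      apply: (cent_Sylow _ r) => //; rewrite ?groupM // not_cS ?groupM //.
      move: ncSx cSy; rewrite !sub_cent1 => ncSx cSy.
      by rewrite groupMr.
    by apply: (cent_Sylow _ r) => //; apply: not_cS.
  have:= pnat_index_Hall sylR cRP.
  by rewrite p'natE // rG.
have p'x x: x \in P -> p^'.-nat #|G : 'C_G[x]|.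
  move=> Px; apply: pnat_index_Hall sylS _.
  by rewrite subsetI sSG sub_cent1 (subsetP cPS).
have exE q: exists E : {group gT}, (pred2 p q).-Hall(G) E && (S \subset E).
  have pqS: (pred2 p q).-group S by apply: pi_pnat pS _; rewrite !inE eqxx.
  by have [E hallE sSE] := Hall_superset solG sSG pqS; exists E; rewrite hallE.
pose E q := xchoose (exE q).
have [hallE sSE]:
  (forall q, (pred2 p q).-Hall(G) (E q)) /\ (forall q, S \subset E q).
- by split=> q; have /andP[] := xchooseP (exE q).
have index_pnat q x: x \in P -> ~~ (E q \subset 'C[x]) -> q.-nat #|G : 'C_G[x]|.
  move=> Px; have [t t_x] := pnat_index x Px; have [<- // | tNq] := eqVneq t q.
  case/negP; apply: cent_Hall (hallE q) _; rewrite ?sSE //.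
  (* A prime divisor of the index equals [t], which is not [q], and it is not [p] because [S]
     centralises [x]. *)
  apply/pnatP=> // r r_pr r_x; rewrite !inE negb_or.
  have /eqnP-> := pnatP _ (indexg_gt0 _ _) t_x r r_pr r_x; rewrite tNq andbT.
  have /eqnP <- := pnatP _ (indexg_gt0 _ _) t_x r r_pr r_x.
  exact: (pnatP _ (indexg_gt0 _ _) (p'x x Px) r r_pr r_x).
have not2 q r x: x \in P -> q != r -> ~~ (E q \subset 'C[x]) ->
  E r \subset 'C[x].
- move=> Px qNr ncEq; apply/idPn=> ncEr; case/negP: (ncEq).
  apply: cent_Hall (hallE q) _; rewrite ?sSE //.
  rewrite (@pnat_1 q _ (index_pnat q x Px ncEq)) //.
  by apply: pi_pnat (index_pnat r x Px ncEr) _; rewrite !inE eq_sym.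
(* The bound makes the case distinction decidable, and it covers all prime divisors of [#|G|]. If
   [x] fails at [r] and [y] at [t], then [x * y] fails at both, contrary to [not2]. *)
have [q cEP]: exists q, forall t, t < #|G|.+1 -> t != q -> E t \subset 'C(P).
  have [/existsP[/= r] | /existsPn cEP] :=
    boolP [exists r : 'I_#|G|.+1, ~~ (E r \subset 'C(P))].
    rewrite centsC => /subsetPn[x Px]; rewrite -sub_cent1 => ncEx.
    exists r => t _ tNr; rewrite centsC; apply/subsetP=> y Py.
    rewrite -sub_cent1; apply/idPn=> ncEy.
    have rNt: r != t :> nat by rewrite eq_sym.
    have cEx := not2 r t x Px rNt ncEx; have cEy := not2 t r y Py tNr ncEy.
    case/negP: ncEx; have:= not2 t r (x * y) (groupM Px Py) tNr.
    rewrite (cent_mul x) // => /(_ ncEy).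
    by move: cEy; rewrite !sub_cent1 => cEy; rewrite groupMr.
  (* With no exceptional index the witness is arbitrary. *)
  by exists p => t ltt _; have := cEP (Ordinal ltt); rewrite negbK.
exists q; apply/pnatP=> // t t_pr t_i; apply/idPn=> /= tNq.
have cEC: E t \subset 'C_G(P).
  rewrite subsetI (pHall_sub (hallE t)) cEP // ltnS dvdn_leq //.
  exact: dvdn_trans t_i (dvdn_indexg _ _).
have:= pnat_index_Hall (hallE t) cEC.
move/(pnatP _ (indexg_gt0 _ _))/(_ t t_pr t_i).
by rewrite !inE eqxx orbT.
Qed.

Theorem theorem6 (gT : finGroupType) (G A B : {group gT})
  (sAG : A \subset G) (sBG : B \subset G) (defG : A * B = G)
  (Ap Bp : nat -> {group gT})
  (sylA : forall p : nat, prime p -> p.-Sylow(A) (Ap p))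
  (sylB : forall p : nat, prime p -> p.-Sylow(B) (Bp p)) :
  baer_factorisation G A B <->
  (forall p : nat, prime p ->
     prime_power #|G : 'C_G(Ap p)| /\ prime_power #|G : 'C_G(Bp p)|).
Proof.
(* Some conjugate of [x] under [X] lies in [P], so its centraliser contains that of [P] and its
   index divides a power of [q]. *)
have sub_cent (X P : {group gT}) p :
    X \subset G -> p.-Sylow(X) P -> prime_power #|G : 'C_G(P)| ->
  forall x, x \in X -> p.-elt x -> prime_power #|G : 'C_G[x]|.
- move=> sXG sylP /prime_powerP[q q_P] x Xx p_x; apply/prime_powerP; exists q.
  have [||g Xg sxP] := Sylow_Jsub sylP (_ : <[x]> \subset X) _.
  - by rewrite cycle_subG.
  - exact: p_x.
  rewrite -(index_cent1J x (subsetP sXG g Xg)).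
  have sC: 'C_G(P) \subset 'C_G[x ^ g].
    by rewrite setIS // -cent_cycle cycleJ centS.
  exact: pnat_dvd (indexgS G sC) q_P.
split=> [[_ indAB] p p_pr | ind].
  have ind: pelt_pindex G (A :|: B).
    move=> q x ABx q_x; apply/prime_powerP/indAB=> //.
    by apply/prime_powerP; exists q.
  split; apply/prime_powerP; first exact: pindex_cent_Sylow ind (sylA p p_pr).
  (* The factors may be exchanged: since [A * B] is a group, [A] and [B] permute. *)
  apply: (@pindex_cent_Sylow _ p G B A) (sylB p p_pr); rewrite 1?setUC //.
  by rewrite -[RHS]defG; apply/commute_sym/comm_group_setP; rewrite defG groupP.
split=> // x /setUP ABx [p [k [p_pr ox]]].
have p_x: p.-elt x by rewrite /p_elt ox pnatX pnat_id.
have [indA indB] := ind p p_pr.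
case: ABx => [Ax | Bx]; first exact: sub_cent sAG (sylA p p_pr) indA x Ax p_x.
exact: sub_cent sBG (sylB p p_pr) indB x Bx p_x.
Qed.
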